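(* Let $0<p<1$, $q=1-p$, $r=q/p$, and let $N$ and $i$ be integers with $1\le i\le N$. A gambler starts with $i$ dollars and plays independent one-dollar bets, her fortune increasing by one dollar with probability $p$ and decreasing by one dollar with probability $q$ in each bet, until her fortune first reaches $0$ or $N$. Let $W_{i:N}$ be the conditional expected number of bets played, given that her fortune reaches $N$ dollars before reaching $0$. Then $$W_{i:N}=\begin{cases}\dfrac{1}{3}(N-i)(N+i) & \text{if } r=1,\\[2mm] \dfrac{r+1}{r-1}\left[N\,\dfrac{r^N+1}{r^N-1}-i\,\dfrac{r^i+1}{r^i-1}\right] & \text{if } r\neq 1.\end{cases}$$
   Context: The gambler's fortune is a nearest-neighbour random walk on the integers: if $X_1,X_2,\dots$ are i.i.d. with $P(X_k=1)=p$, $P(X_k=-1)=q=1-p$, then the fortune after $n$ bets is $S_n=i+X_1+\cdots+X_n$. The game ends at time $T=\min\{n\ge 0: S_n\in\{0,N\}\}$. The event that the gambler ''quits a winner'' is $W=\{S_T=N\}$, and $W_{i:N}=E[T\mid S_T=N]$. In particular, if $i=N$ then no bets are played. The constant $r=q/p$ is the odds of losing a bet. *)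

(* Defs.v *)
From HB Require Import structures.
From mathcomp Require Import all_boot all_order all_algebra.
From mathcomp Require Import finmap.
From mathcomp Require Import all_classical all_reals all_analysis.

Set Implicit Arguments.
Unset Strict Implicit.
Unset Printing Implicit Defensive.

Import Order.TTheory GRing.Theory Num.Theory.
Import numFieldNormedType.Exports.

Local Open Scope classical_set_scope.
Local Open Scope ring_scope.

Section Probability.
Context {d : measure_display} {Omega : measurableType d} {R : realType}.
Variable P : probability Omega R.

Definition mutually_independent (I : choiceType) (X : I -> {RV P >-> R}) :=
  forall (J : {fset I}) (B : I -> set R),
    (forall k, k \in J -> measurable (B k)) ->
    (P (\bigcap_(k in [set` J]) (X k @^-1` B k)) =
     \prod_(k <- J) P (X k @^-1` B k))%E.

(* E[Y | A] for an event A of positive probability; Y may take infinite values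
   outside A. *)
Definition conditional_expectation (Y : Omega -> \bar R) (A : set Omega) :
  \bar R := ((\int[P]_(w in A) Y w) / P A)%E.

End Probability.

Section GamblersRuin.
Context {Omega : Type} {R : realType}.
(* [X k] is the outcome of bet number k + 1; [i] is the initial fortune and [N]
   the target. *)
Variables (X : nat -> Omega -> R) (i N : nat).

Definition fortune (n : nat) (w : Omega) : R := i%:R + \sum_(k < n) X k w.

(* The infimum is a minimum when the set is nonempty, and +oo (the game never
   ends) when it is empty. *)
Definition duration (w : Omega) : \bar R :=
  ereal_inf [set (n%:R)%:E | n in
    [set n : nat | fortune n w = 0 \/ fortune n w = N%:R]].

(* The event S_T = N, including T < +oo. *)
Definition quits_winner : set Omega :=
  [set w | exists2 n : nat, duration w = (n%:R)%:E & fortune n w = N%:R].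

End GamblersRuin.

(* Main.v *)
Require Import Defs.
From HB Require Import structures.
From mathcomp Require Import all_boot all_order all_algebra.
From mathcomp Require Import finmap ring lra.
From mathcomp Require Import all_classical all_reals all_analysis.
From mathcomp Require Import measurable_realfun.

(** Let a_n(j) be the probability that a walk started at j first meets {0, N} at
    time n, and does so at N. The event that the gambler wins is the disjoint
    union over n of the events that she wins at time exactly n, on which the
    duration is the constant n; hence
      P(W) = sum_n a_n(i)   and   E[T; W] = sum_n n a_n(i),
    and the theorem asks for the quotient of these two series.

    Conditioning on the first bet gives
      a_(n+1)(j) = p a_n(j+1) + q a_n(j-1)   for 0 < j < N,
    where a_(n+1)(0) = a_(n+1)(N) = 0. Independence is a product rule for finite
    families of bets, so the recursion is not proved by restarting the walk:
    [past_first_win] carries along an arbitrary condition on the bets already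
    made, and the induction on n adds one bet at a time to that past.

    The partial sums of both series are nondecreasing in n and bounded: those of
    a_n by 1, those of n a_n by a strict supersolution of the recursion
    ([win_time_bound]). So they converge, and their limits A and G satisfy
      A(j) = p A(j+1) + q A(j-1),           A(0) = 0, A(N) = 1,
      G(j) = p G(j+1) + q G(j-1) + A(j),    G(0) = G(N) = 0,
    the extra term A(j) counting the bet just played. Such boundary value problems
    have at most one solution ([first_step_unique]), and closed forms solve them
    ([first_step_fair], [first_step_biased]). The theorem is the value of G / A
    at i. *)

Set Implicit Arguments.
Unset Strict Implicit.
Unset Printing Implicit Defensive.

Import Order.TTheory GRing.Theory Num.Theory.
Import numFieldNormedType.Exports.

Local Open Scope classical_set_scope.
Local Open Scope ring_scope.

(** * First-step equations and the two series *)

Section FirstStep.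
Context {R : realType}.
Variables (p : R) (N : nat).
Implicit Types (j k n : nat) (f u v : nat -> R).

Definition first_step f u :=
  forall j, (j.+1 < N)%N -> u j.+1 = p * u j.+2 + (1 - p) * u j + f j.+1.

(** The slopes of the difference w of two solutions are multiplied by
    (1 - p) / p at each step, so w(j) is w(1) times a sum of positive powers that
    cannot vanish at j = N. *)
Lemma first_step_unique f u v : 0 < p < 1 -> (0 < N)%N ->
  first_step f u -> first_step f v -> u 0%N = v 0%N -> u N = v N ->
  forall j, (j <= N)%N -> u j = v j.
Proof.
move=> /andP[p0 p1] N0 fu fv uv0 uvN.
pose w j := u j - v j.
have w0 : w 0%N = 0 by rewrite /w uv0 subrr.
have slope j : (j < N)%N -> w j.+1 - w j = w 1%N * ((1 - p) / p) ^+ j.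
  elim: j => [|j IH] jN; first by rewrite w0 subr0 expr0 mulr1.
  rewrite exprS mulrCA -IH ?(ltnW jN)// /w (fu j)// (fv j)//.
  by field; rewrite gt_eqF.
have wE j : (j <= N)%N -> w j = w 1%N * \sum_(k < j) ((1 - p) / p) ^+ k.
  elim: j => [|j IH] jN; first by rewrite big_ord0 mulr0.
  by rewrite big_ord_recr/= mulrDr -IH ?(ltnW jN)// -slope// addrC subrK.
have w1 : w 1%N = 0.
  have : w N = 0 by rewrite /w uvN subrr.
  rewrite wE// => /eqP; rewrite mulf_eq0 => /orP[/eqP//|].
  case: (N) N0 => // n _; rewrite big_ord_recl expr0 gt_eqF// ltr_pwDl//.
  by apply: sumr_ge0 => k _; rewrite exprn_ge0// divr_ge0 ?subr_ge0// ltW.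
by move=> j jN; apply/eqP; rewrite -subr_eq0 -/(w j) wE// w1 mul0r.
Qed.

(** The numbers a_n(j) of the introduction. At time 0 the walk has won exactly
    when j = N; a walk standing on 0 or N at time 0 cannot first meet the boundary
    later, whence the zeros at positive times. *)
Fixpoint win_prob n j : R :=
  if n is n'.+1 then
    if (j == 0) || (j == N) then 0
    else p * win_prob n' j.+1 + (1 - p) * win_prob n' j.-1
  else (j == N)%:R.

Definition win_mass n j := \sum_(k < n) win_prob k j.
Definition win_time n j := \sum_(k < n) k%:R * win_prob k j.

Lemma win_prob_ge0 n j : 0 < p < 1 -> 0 <= win_prob n j.
Proof.
move=> /andP[p0 p1]; elim: n j => [|n IH] j //=.
by case: ifP => // _; rewrite addr_ge0// mulr_ge0// ?subr_ge0// ltW.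
Qed.

Lemma win_prob_interior n j : (j.+1 < N)%N ->
  win_prob n.+1 j.+1 = p * win_prob n j.+2 + (1 - p) * win_prob n j.
Proof. by move=> jN /=; rewrite ltn_eqF. Qed.

Lemma win_mass0 n : (0 < N)%N -> win_mass n 0 = 0.
Proof.
by move=> N0; apply: big1 => -[[|k] kn] _ //=; rewrite ltn_eqF.
Qed.

Lemma win_massN n : win_mass n.+1 N = 1.
Proof.
rewrite /win_mass big_ord_recl/= eqxx big1 ?addr0// => k _.
by rewrite orbT.
Qed.

Lemma win_time0 n : (0 < N)%N -> win_time n 0 = 0.
Proof.
by move=> N0; apply: big1 => -[[|k] kn] _ /=; rewrite ?mul0r ?mulr0.
Qed.

Lemma win_timeN n : win_time n N = 0.
Proof.
by apply: big1 => -[[|k] kn] _ /=; rewrite ?mul0r ?eqxx ?orbT ?mulr0.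
Qed.

Lemma win_massS n j : (j.+1 < N)%N ->
  win_mass n.+1 j.+1 = p * win_mass n j.+2 + (1 - p) * win_mass n j.
Proof.
move=> jN; rewrite /win_mass big_ord_recl [win_prob 0 _]/= ltn_eqF// add0r.
rewrite !mulr_sumr -big_split/=; apply: eq_bigr => k _.
exact: win_prob_interior.
Qed.

(** From (k + 1) a_(k+1) = k a_(k+1) + a_(k+1): the bet just played adds one to the
    duration of every winning game, which contributes the source term. *)
Lemma win_timeS n j : (j.+1 < N)%N ->
  win_time n.+1 j.+1 =
  p * win_time n j.+2 + (1 - p) * win_time n j + win_mass n.+1 j.+1.
Proof.
move=> jN; rewrite win_massS// /win_time /win_mass big_ord_recl/= mul0r add0r.
rewrite !mulr_sumr -!big_split; apply: eq_bigr => k _.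
(* The head of the sum has weight 0, so term k of the remainder has index k + 1. *)
rewrite -[LHS]/(k.+1%:R * win_prob k.+1 j.+1) win_prob_interior// -natr1 /=.
by ring.
Qed.

Hypothesis p01 : 0 < p < 1.

Lemma nondecreasing_win_mass j : nondecreasing_seq (win_mass ^~ j).
Proof.
apply/nondecreasing_seqP => n.
by rewrite /win_mass big_ord_recr/= lerDl win_prob_ge0.
Qed.

Lemma nondecreasing_win_time j : nondecreasing_seq (win_time ^~ j).
Proof.
apply/nondecreasing_seqP => n.
by rewrite /win_time big_ord_recr/= lerDl mulr_ge0// win_prob_ge0.
Qed.

Lemma win_mass_le1 n j : (0 < N)%N -> (j <= N)%N -> win_mass n j <= 1.
Proof.
move=> N0; elim: n j => [|n IH] j jN; first by rewrite /win_mass big_ord0.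
case: j jN => [_|j jN]; first by rewrite win_mass0.
have [->|jnN] := eqVneq j.+1 N; first by rewrite win_massN.
have jltN : (j.+1 < N)%N by rewrite ltn_neqAle jnN.
rewrite win_massS//.
have := IH _ jltN; have := IH _ (ltnW jN).
by case/andP: p01 => p0 p1 ? ?; nra.
Qed.

(** With M = 2 / p, the function h(j) = M^N - M^j is nonnegative for j <= N and
    satisfies h(j) >= p h(j+1) + q h(j-1) + 1, because p M^(j+1) = 2 M^j and
    M^j >= 1. As the partial sums of a_n are at most 1, h dominates the partial
    sums of n a_n by induction. *)
Lemma win_time_bound n j : (0 < N)%N -> (j <= N)%N ->
  win_time n j <= (2 / p) ^+ N - (2 / p) ^+ j.
Proof.
case/andP: (p01) => p0 p1 N0.
have M1 : 1 <= 2 / p by rewrite ler_pdivlMr//; lra.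
have h0 k : (k <= N)%N -> 0 <= (2 / p) ^+ N - (2 / p) ^+ k.
  by move=> kN; rewrite subr_ge0 ler_weXn2l.
elim: n j => [|n IH] j jN; first by rewrite /win_time big_ord0 h0.
case: j jN => [_|j jN]; first by rewrite win_time0// h0.
have [->|jnN] := eqVneq j.+1 N; first by rewrite win_timeN subrr.
have jltN : (j.+1 < N)%N by rewrite ltn_neqAle jnN.
rewrite win_timeS//.
have mass1 := win_mass_le1 n.+1 N0 jN.
have up := ler_wpM2l (ltW p0) (IH _ jltN).
have down : (1 - p) * win_time n j <= (1 - p) * ((2 / p) ^+ N - (2 / p) ^+ j).
  by rewrite ler_wpM2l ?subr_ge0 ?(ltW p1)// IH// ltnW.
have pM : p * (2 / p) ^+ j.+2 = 2 * (2 / p) ^+ j.+1.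
  by rewrite exprS; field; rewrite gt_eqF.
have Mj : 1 <= (2 / p) ^+ j by rewrite exprn_ege1.
have Mj1 : 1 <= (2 / p) ^+ j.+1 by rewrite exprn_ege1.
move: up; rewrite mulrBr pM => up.
nra.
Qed.

Lemma is_cvg_win_mass j : (0 < N)%N -> (j <= N)%N -> cvgn (win_mass ^~ j).
Proof.
move=> N0 jN; apply: nondecreasing_is_cvgn; first exact: nondecreasing_win_mass.
by exists 1 => _ [n _ <-]; exact: win_mass_le1.
Qed.

Lemma is_cvg_win_time j : (0 < N)%N -> (j <= N)%N -> cvgn (win_time ^~ j).
Proof.
move=> N0 jN; apply: nondecreasing_is_cvgn; first exact: nondecreasing_win_time.
by exists ((2 / p) ^+ N - (2 / p) ^+ j) => _ [n _ <-]; exact: win_time_bound.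
Qed.

(** The recursions pass to the limit, after which uniqueness identifies it. *)
Lemma cvg_win_mass u : (0 < N)%N -> u 0%N = 0 -> u N = 1 ->
  first_step (fun=> 0) u ->
  forall j, (j <= N)%N -> win_mass n j @[n --> \oo] --> u j.
Proof.
move=> N0 u0 uN stepu j jN.
rewrite -(@first_step_unique (fun=> 0) (fun j => limn (win_mass ^~ j)) u) //.
- exact: is_cvg_win_mass.
- move=> k kN; rewrite addr0; apply/cvg_lim => //.
  rewrite -(cvg_shiftS (win_mass ^~ k.+1))/=.
  under eq_fun do rewrite win_massS//.
  apply: cvgD; apply: cvgMl_tmp; apply: is_cvg_win_mass => //.
  by do 2!apply: ltnW.
- by rewrite u0; under eq_fun do rewrite win_mass0//; exact: lim_cst.
- rewrite uN; apply/cvg_lim => //; rewrite -(cvg_shiftS (win_mass ^~ N))/=.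
  by under eq_fun do rewrite win_massN; exact: cvg_cst.
Qed.

Lemma cvg_win_time u v : (0 < N)%N -> u 0%N = 0 -> u N = 1 ->
  first_step (fun=> 0) u -> v 0%N = 0 -> v N = 0 -> first_step u v ->
  forall j, (j <= N)%N -> win_time n j @[n --> \oo] --> v j.
Proof.
move=> N0 u0 uN stepu v0 vN stepv j jN.
rewrite -(@first_step_unique u (fun j => limn (win_time ^~ j)) v) //.
- exact: is_cvg_win_time.
- move=> k kN; apply/cvg_lim => //.
  rewrite -(cvg_shiftS (win_time ^~ k.+1))/=.
  under eq_fun do rewrite win_timeS//.
  apply: cvgD.
    apply: cvgD; apply: cvgMl_tmp; apply: is_cvg_win_time => //.
    by do 2!apply: ltnW.
  rewrite (cvg_shiftS (win_mass ^~ k.+1)).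
  by apply: cvg_win_mass => //; exact: ltnW.
- by rewrite v0; under eq_fun do rewrite win_time0//; exact: lim_cst.
- by rewrite vN; under eq_fun do rewrite win_timeN; exact: lim_cst.
Qed.
End FirstStep.

(** * Closed-form solutions *)

Lemma first_step_fair {R : realType} (N : nat) : (0 < N)%N ->
  first_step (1 / 2) N (fun=> 0) (fun j => j%:R / N%:R : R) /\
  first_step (1 / 2) N (fun j => j%:R / N%:R : R)
    (fun j => 1 / 3 * (N%:R - j%:R) * (N%:R + j%:R) * (j%:R / N%:R)).
Proof.
move=> N0; have N_neq0 : N%:R != 0 :> R by rewrite pnatr_eq0 -lt0n.
by split=> j jN; rewrite -!natr1; field; rewrite ?N_neq0.
Qed.

(** Here 1 and r^j are the solutions without source, and for g(j) = j (r^j + 1) one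
    finds g(j) - p g(j+1) - q g(j-1) = - (r - 1) (r^j - 1) / (1 + r), a multiple
    of the source; the second function combines g with them so as to vanish
    at N. *)
Lemma first_step_biased {R : realType} (r : R) (N : nat) :
  1 + r != 0 -> r ^+ N - 1 != 0 ->
  first_step (1 + r)^-1 N (fun=> 0) (fun j => (r ^+ j - 1) / (r ^+ N - 1)) /\
  first_step (1 + r)^-1 N (fun j => (r ^+ j - 1) / (r ^+ N - 1))
    (fun j => (r + 1) / (r - 1) *
       (N%:R * ((r ^+ N + 1) / (r ^+ N - 1)) * ((r ^+ j - 1) / (r ^+ N - 1)) -
        j%:R * ((r ^+ j + 1) / (r ^+ N - 1)))).
Proof.
move=> r1_neq0 rN_neq1; have r_neq1 : r - 1 != 0.
  by apply: contraNneq rN_neq1 => /subr0_eq ->; rewrite expr1n subrr.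
split=> j jN; rewrite !exprS -?natr1; field;
  by rewrite ?r1_neq0 ?rN_neq1 ?r_neq1.
Qed.

(** * Winning at a given time *)

Section FirstWin.
Context {Omega : Type} {R : realType}.
Implicit Types (X : nat -> Omega -> R) (N i j k n : nat) (w : Omega).

Definition first_win X N j n : set Omega :=
  [set w | (forall k, (k < n)%N -> fortune X j k w <> 0 /\ fortune X j k w <> N%:R)
           /\ fortune X j n w = N%:R].

Lemma duration_first_win X N i n w :
  first_win X N i n w -> duration X i N w = (n%:R)%:E.
Proof.
move=> [before hit]; apply/eqP; rewrite eq_le; apply/andP; split.
  by apply: ereal_inf_lbound; exists n => //; right.
apply: le_ereal_inf_tmp => _ [k hitk <-]; rewrite lee_fin ler_nat leqNgt.
by apply/negP => /before[? ?]; case: hitk.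
Qed.

Lemma quits_winnerE X N i : quits_winner X i N = \bigcup_n first_win X N i n.
Proof.
apply/seteqP; split => w /=; last first.
  by case=> n _ win; exists n; [exact: duration_first_win|case: win].
case=> n durn hit; exists n => //; split => // k kn.
suff nohit : ~ (fortune X i k w = 0 \/ fortune X i k w = N%:R).
  by split=> h; apply: nohit; [left|right].
move=> hitk; have : (duration X i N w <= (k%:R)%:E)%E.
  by apply: ereal_inf_lbound; exists k.
by rewrite durn lee_fin ler_nat leqNgt kn.
Qed.

Lemma trivIset_first_win X N i : trivIset setT (first_win X N i).
Proof.
move=> m n _ _ [w [/duration_first_win + /duration_first_win]].
by move=> -> [/eqP]; rewrite eqr_nat => /eqP.
Qed.

Lemma fortuneS X i n w :
  fortune X i n.+1 w = X 0%N w + fortune (fun k => X k.+1) i n w.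
Proof. by rewrite /fortune big_ord_recl addrCA. Qed.

(** The increment is given through j', so that both outcomes of the first bet are
    instances (j' = j + 1 and j' = j - 1). *)
Lemma first_winS X N j j' n w : (0 < j < N)%N -> X 0%N w = j'%:R - j%:R ->
  first_win X N j n.+1 w <-> first_win (fun k => X k.+1) N j' n w.
Proof.
move=> /andP[j0 jN] X0.
have shift k : fortune X j k.+1 w = fortune (fun k => X k.+1) j' k w.
  by rewrite fortuneS X0 /fortune addrA subrK.
have start : fortune X j 0 w = j%:R by rewrite /fortune big_ord0 addr0.
split=> -[before hit]; split; rewrite ?shift// -?shift//.
  by move=> k kn; rewrite -shift; exact: before.
move=> [_|k kn]; last by rewrite shift; exact: before.
rewrite start; split; apply/eqP; first by rewrite pnatr_eq0 -lt0n.
by rewrite eqr_nat ltn_eqF.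
Qed.

Lemma first_win0 X N j w : first_win X N j 0 w <-> j = N.
Proof.
rewrite /first_win/= /fortune big_ord0 addr0; split=> [[_ /eqP]|->//].
by rewrite eqr_nat => /eqP.
Qed.

Lemma first_win_absorbed X N j n : (j == 0%N) || (j == N) ->
  first_win X N j n.+1 = set0.
Proof.
move=> jabs; apply/seteqP; split=> // w [/(_ 0%N erefl)].
by rewrite /fortune big_ord0 addr0; case/orP: jabs => /eqP -> [].
Qed.
End FirstWin.

(** * Probabilities of winning at a given time *)

Section Measure.
Context {d : measure_display} {Omega : measurableType d} {R : realType}.
Variable P : probability Omega R.
Implicit Types (X : nat -> {RV P >-> R}) (N i j k m n : nat) (B : nat -> set R).

Lemma measurable_fortune X i n :
  measurable_fun setT (fortune X i n : Omega -> R).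
Proof.
by apply: measurable_funD; [exact: measurable_cst|exact: measurable_sum].
Qed.

Lemma measurable_first_win X N j n : measurable (first_win X N j n).
Proof.
rewrite (_ : first_win _ _ _ _ =
  (\bigcap_(k < n) (fortune X j k @^-1` ~` [set 0; N%:R])) `&`
  (fortune X j n @^-1` [set N%:R])); last first.
  apply/seteqP; split=> w [before hit]; split=> // k kn.
    by case: (before k kn) => ? ? [].
  by have /= := before k kn => nohit; split=> h; apply: nohit; [left|right].
have mpre k (A : set R) : measurable A -> measurable (fortune X j k @^-1` A).
  by move=> mA; rewrite -[_ @^-1` _]setTI; exact: measurable_fortune.
apply: measurableI; last exact: mpre.
by apply: bigcap_measurableType => k _; apply/mpre/measurableC/measurableU.
Qed.

(** Splitting along the outcomes of a bet, which exhaust the sample space only up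
    to a null event. *)
Lemma prob_split (E A B : set Omega) :
  measurable E -> measurable A -> measurable B ->
  A `&` B = set0 -> (P A + P B = 1)%E -> P E = (P (E `&` A) + P (E `&` B))%E.
Proof.
move=> mE mA mB AB0 PAB.
have mAB : measurable (A `|` B) by exact: measurableU.
have PU : P (A `|` B) = 1%E by rewrite measureU.
have null : P (E `\` (A `|` B)) = 0%E.
  apply/eqP; rewrite -measure_le0.
  have <- : P (~` (A `|` B)) = 0%E by rewrite probability_setC// PU subee.
  apply: le_measure; rewrite ?inE; [exact: measurableD|exact: measurableC|].
  by move=> w [].
rewrite (measureDI P mE mAB) [X in (X + _ = _)%E]null add0e setIUr.
rewrite measureU//; try exact: measurableI.
by rewrite setIACA AB0 setI0.
Qed.

Definition past X B m := \bigcap_(k < m) X k @^-1` B k.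

Lemma measurable_past X B m : (forall k, measurable (B k)) ->
  measurable (past X B m).
Proof.
by move=> mB; apply: bigcap_measurableType => k _; exact: measurable_funPTI.
Qed.

Lemma past_recr X B m : past X B m.+1 = past X B m `&` X m @^-1` B m.
Proof.
apply/seteqP; split=> w.
  by move=> h; split=> [k km|]; apply: h => //=; exact: ltnW.
by move=> [h1 h2] k /=; rewrite ltnS leq_eqVlt => /predU1P[->//|/h1].
Qed.

Lemma past_agree X B B' m : (forall k, (k < m)%N -> B k = B' k) ->
  past X B m = past X B' m.
Proof. by move=> BB'; apply: eq_bigcapr => k /BB' ->. Qed.

Lemma indep_past X B m : mutually_independent X ->
  (forall k, measurable (B k)) ->
  P (past X B m) = (\prod_(k < m) P (X k @^-1` B k))%E.
Proof.
move=> indepX mB.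
have [J JE prodJ] : exists2 J : {fset nat}, [set` J] = `I_m &
    forall F : nat -> \bar R, (\prod_(k <- J) F k = \prod_(k < m) F k)%E.
  (* The set {0, ..., m-1} as a finite set, with products indexed by 'I_m. *)
  elim: m => [|m [J JE prodJ]].
    exists fset0; last by move=> F; rewrite big_ord0 big_seq_fset0.
    by apply/seteqP; split=> k //=; rewrite inE.
  have memJ k : (k \in J) = (k < m)%N.
    have [Jk kJ] : [set` J] k <-> `I_m k by rewrite JE.
    exact/idP/idP.
  exists (m |` J)%fset.
    by apply/seteqP; split=> k /=; rewrite !inE memJ ltnS [(k <= m)%N]leq_eqVlt.
  move=> F; rewrite big_fsetU1/= ?memJ ?ltnn//.
  by rewrite big_ord_recr/= muleC prodJ.
by rewrite /past -[X in \bigcap_(_ in X) _]JE indepX.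
Qed.

Lemma indep_pastS X B m : mutually_independent X ->
  (forall k, measurable (B k)) ->
  P (past X B m.+1) = (P (past X B m) * P (X m @^-1` B m))%E.
Proof. by move=> indepX mB; rewrite !indep_past// big_ord_recr. Qed.

(** A condition B on the first m bets is independent of a later win, and the later
    win has probability [win_prob]. The induction on n needs every m and B: once
    bet m is revealed, its outcome is absorbed into the past. *)
Lemma past_first_win X p N : (0 < N)%N -> mutually_independent X ->
  (forall k, P (X k @^-1` [set 1]) = p%:E) ->
  (forall k, P (X k @^-1` [set -1]) = (1 - p)%:E) ->
  forall n m j B, (j <= N)%N -> (forall k, measurable (B k)) ->
  P (past X B m `&` first_win (fun k => X (m + k)%N) N j n) =
  (P (past X B m) * (win_prob p N n j)%:E)%E.
Proof.
move=> N0 indepX Pwin Plose; elim=> [|n IH] m j B jN mB.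
  have [->|jneN] := eqVneq j N.
    rewrite /= eqxx mule1; congr (P _); apply/seteqP; split=> [w []//|w h].
    by split=> //; apply/first_win0.
  rewrite /= (negbTE jneN) mule0 -(measure0 P); congr (P _).
  by apply/seteqP; split=> // w [_ /first_win0 /eqP]; rewrite (negbTE jneN).
have [jabs|jint] := boolP ((j == 0%N) || (j == N)).
  by rewrite first_win_absorbed// setI0 measure0 /= jabs mule0.
have {jint} : (0 < j < N)%N.
  by rewrite lt0n ltn_neqAle jN andbT -negb_or.
case: j jN => // j jN /= jltN.
have mW := measurable_first_win (fun k => X (m + k)%N) N j.+1 n.+1.
have mI := measurableI _ _ (measurable_past X m mB) mW.
have mX c : measurable (X m @^-1` [set c]) by exact: measurable_funPTI.
have step c j' : c = j'%:R - j.+1%:R :> R -> (j' <= N)%N ->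
    P (past X B m `&` first_win (fun k => X (m + k)%N) N j.+1 n.+1
        `&` X m @^-1` [set c]) =
    (P (past X B m) * P (X m @^-1` [set c]) * (win_prob p N n j')%:E)%E.
  (* B' also requires bet m to have the outcome c. *)
  move=> cE j'N; pose B' k := if k == m then [set c] else B k.
  have mB' k : measurable (B' k) by rewrite /B'; case: ifP.
  have pastB' : past X B' m = past X B m.
    by apply: past_agree => k km; rewrite /B' ltn_eqF.
  have B'm : B' m = [set c] by rewrite /B' eqxx.
  rewrite -pastB' -{2}B'm -indep_pastS// -IH// past_recr B'm.
  congr (P _); apply/seteqP; split=> w /=.
    move=> [[pastw win] Xm]; split=> //.
    move: win; rewrite (@first_winS _ _ _ _ _ j')//=; last by rewrite addn0 Xm.
    by under eq_fun do rewrite addnS.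
  move=> [[pastw Xm] win]; split=> //; split=> //.
  rewrite (@first_winS _ _ _ _ _ j')//=; last by rewrite addn0 Xm.
  by under eq_fun do rewrite addnS.
rewrite (@prob_split _ (X m @^-1` [set 1]) (X m @^-1` [set -1]))//.
- rewrite (step 1 j.+2)//; last by rewrite -[j.+2%:R]natr1 addrC addKr.
  rewrite (step (-1) j)//; [|by rewrite -natr1 opprD addNKr|by rewrite ltnW].
  rewrite Pwin Plose -!muleA -!EFinM -muleDr//; first by rewrite -EFinD ltn_eqF.
  exact: fin_num_measure (measurable_past X m mB).
- apply/seteqP; split=> // w [/= -> /eqP].
  by rewrite -subr_eq0 opprK (_ : 1 + 1 = 2)// pnatr_eq0.
- by rewrite Pwin Plose -EFinD addrC subrK.
Qed.

(** * The conditional expectation *)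

Lemma prob_first_win X p N n i : (0 < N)%N -> (i <= N)%N ->
  mutually_independent X ->
  (forall k, P (X k @^-1` [set 1]) = p%:E) ->
  (forall k, P (X k @^-1` [set -1]) = (1 - p)%:E) ->
  P (first_win X N i n) = (win_prob p N n i)%:E.
Proof.
move=> N0 iN indepX Pwin Plose.
have := past_first_win N0 indepX Pwin Plose n 0 iN (fun=> @measurableT _ R).
suff -> : past X (fun=> setT) 0 = setT by rewrite setTI probability_setT mul1e.
by apply/seteqP; split.
Qed.

Lemma integral_duration X N i :
  (\int[P]_(w in quits_winner X i N) duration X i N w =
   \sum_(0 <= n <oo) n%:R%:E * P (first_win X N i n))%E.
Proof.
have mF n := measurable_first_win X N i n.
have durE n w : w \in first_win X N i n -> duration X i N w = cst n%:R%:E w.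
  by rewrite inE; exact: duration_first_win.
rewrite quits_winnerE ge0_integral_bigcup//.
- apply: eq_eseriesr => n _.
  by rewrite (eq_integral (cst n%:R%:E)) ?integral_cst// => w /durE.
- apply/measurable_fun_bigcup => // n.
  by apply/(eq_measurable_fun (cst n%:R%:E)) => // w /durE.
- by move=> w [n _ win]; rewrite (duration_first_win win) lee_fin.
- exact: trivIset_first_win.
Qed.

Lemma conditional_duration X p N i (u v : nat -> R) : 0 < p < 1 ->
  (0 < N)%N -> (i <= N)%N ->
  mutually_independent X ->
  (forall k, P (X k @^-1` [set 1]) = p%:E) ->
  (forall k, P (X k @^-1` [set -1]) = (1 - p)%:E) ->
  u 0%N = 0 -> u N = 1 -> first_step p N (fun=> 0) u ->
  v 0%N = 0 -> v N = 0 -> first_step p N u v ->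
  u i != 0 ->
  conditional_expectation P (duration X i N) (quits_winner X i N) =
  (v i / u i)%:E.
Proof.
move=> p01 N0 iN indepX Pwin Plose u0 uN stepu v0 vN stepv ui.
have sumE (a : nat -> R) (l : R) : (\sum_(k < n) a k) @[n --> \oo] --> l ->
    (\sum_(0 <= k <oo) (a k)%:E)%E = l%:E :> \bar R.
  move=> al; apply/cvg_lim => //.
  under eq_fun do rewrite sumEFin big_mkord.
  exact: (cvg_comp _ _ al).
have Pfirst n := prob_first_win n N0 iN indepX Pwin Plose.
have PW : P (quits_winner X i N) = (u i)%:E.
  rewrite quits_winnerE measure_semi_bigcup.
  - apply: etrans (sumE _ _ (cvg_win_mass p01 N0 u0 uN stepu iN)).
    by apply: eq_eseriesr => n _; exact: Pfirst.
  - by move=> n; exact: measurable_first_win.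
  - exact: trivIset_first_win.
  - by apply: bigcup_measurable => n _; exact: measurable_first_win.
have ET : (\int[P]_(w in quits_winner X i N) duration X i N w = (v i)%:E)%E.
  rewrite integral_duration.
  apply: etrans (sumE _ _ (cvg_win_time p01 N0 u0 uN stepu v0 vN stepv iN)).
  by apply: eq_eseriesr => n _; rewrite Pfirst.
by rewrite /conditional_expectation ET PW inver (negbTE ui) -EFinM.
Qed.
End Measure.

Theorem theorem2p1 (d : measure_display) (Omega : measurableType d)
    (R : realType) (P : probability Omega R) (p q r : R)
    (p_gt0 : 0 < p) (p_lt1 : p < 1) (qE : q = 1 - p) (rE : r = q / p)
    (N i : nat) (i_ge1 : (1 <= i)%N) (i_leN : (i <= N)%N)
    (X : nat -> {RV P >-> R})
    (X_indep : mutually_independent X)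
    (X_win : forall k, P [set w | X k w = 1] = p%:E)
    (X_lose : forall k, P [set w | X k w = -1] = q%:E) :
  conditional_expectation P (duration X i N) (quits_winner X i N) =
    (if r == 1 then 1 / 3 * (N%:R - i%:R) * (N%:R + i%:R)
     else (r + 1) / (r - 1) *
          (N%:R * ((r ^+ N + 1) / (r ^+ N - 1)) -
           i%:R * ((r ^+ i + 1) / (r ^+ i - 1))))%:E.
Proof.
have p01 : 0 < p < 1 by rewrite p_gt0.
have N0 : (0 < N)%N by exact: leq_trans i_leN.
have N_neq0 : N%:R != 0 :> R by rewrite pnatr_eq0 -lt0n.
have i_neq0 : i%:R != 0 :> R by rewrite pnatr_eq0 -lt0n.
have r_gt0 : 0 < r by rewrite rE divr_gt0// qE subr_gt0.
have r1_neq0 : 1 + r != 0 by rewrite gt_eqF// addr_gt0.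
have pE : p = (1 + r)^-1.
  have pr1 : p * (1 + r) = 1 by rewrite rE qE; field; rewrite gt_eqF.
  by rewrite -[p](mulfK r1_neq0) pr1 mul1r.
have Pwin k : P (X k @^-1` [set 1]) = p%:E by exact: X_win.
have Plose k : P (X k @^-1` [set -1]) = (1 - p)%:E by rewrite -qE; exact: X_lose.
case: eqVneq => [r1|r_neq1].
  have p2 : p = 1 / 2 by rewrite pE r1 div1r.
  have [stepu stepv] := @first_step_fair R N N0.
  rewrite -p2 in stepu stepv.
  rewrite (conditional_duration p01 N0 i_leN X_indep Pwin Plose _ _ stepu _ _ stepv).
  - by congr EFin; field; rewrite N_neq0 i_neq0.
  - by rewrite mul0r.
  - by rewrite divff.
  - by rewrite mul0r mulr0.
  - by rewrite subrr mulr0 !mul0r.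
  - by rewrite mulf_neq0// invr_neq0.
have rX_neq1 n : (0 < n)%N -> r ^+ n - 1 != 0.
  by move=> n0; rewrite subr_eq0 pexpr_eq1 ?(ltW r_gt0).
have rN_neq1 := rX_neq1 N N0; have ri_neq1 := rX_neq1 i i_ge1.
have [stepu stepv] := first_step_biased r1_neq0 rN_neq1.
rewrite -pE in stepu stepv.
rewrite (conditional_duration p01 N0 i_leN X_indep Pwin Plose _ _ stepu _ _ stepv).
- by congr EFin; field; rewrite ri_neq1 rN_neq1 subr_eq0 r_neq1.
- by rewrite expr0 subrr mul0r.
- by rewrite divff.
- by rewrite expr0 subrr !mul0r mulr0 subrr mulr0.
- by rewrite divff// mulr1 subrr mulr0.
- by rewrite mulf_neq0// invr_neq0.
Qed.
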